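(* There exists an absolute constant $C>0$ such that for every $n\in\mathbb N$, every convex body $K\subseteq\mathbb R^n$ with $\max_{x\in K\cap\mathbb Z^n}|\langle x,e_n\rangle|\geq 1$, and every $1\leq p\leq q$, $$\left(\mathbb E|\langle X, e_n\rangle|^p\right)^{\frac1p}\leq\left(\mathbb E|\langle X, e_n\rangle|^q\right)^{\frac1q}\leq C\,\frac{q}{p}\,D_0(K,p)\left(\mathbb E|\langle X, e_n\rangle|^p\right)^{\frac1p},$$ where $X$ is a random vector uniformly distributed on $K\cap\mathbb Z^n$.
   Context: A convex body is a compact convex subset of $\mathbb R^n$ with non-empty interior. $(e_i)_{i=1}^n$ is the canonical basis of $\mathbb R^n$. For a bounded set $L\subseteq\mathbb R^n$, $G_n(L)$ is the cardinality of $L\cap\mathbb Z^n$. Put $C_n=(-1,1)^n$; sums of sets are Minkowski sums. The condition $\max_{x\in K\cap\mathbb Z^n}|\langle x,e_n\rangle|\geq 1$ includes that $K\cap\mathbb Z^n\neq\emptyset$. For a convex body $K\subseteq\mathbb R^n$ satisfying this condition and $p\geq1$, define $$D_0(K,p):=\frac{1+\left(\mathbb E|\langle Y,e_n\rangle|^p\right)^{\frac1p}\left(\frac{G_n(K+C_n)}{G_n(K)}\right)^{\frac1p}}{\left(\mathbb E|\langle X,e_n\rangle|^p\right)^{\frac1p}},$$ where $X$ is uniformly distributed on the finite set $K\cap\mathbb Z^n$ and $Y$ is uniformly distributed on the finite set $(K+C_n)\cap\mathbb Z^n$. An absolute constant is a number independent of all parameters ($n$, $K$, $p$, $q$). *)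

(* Defs.v *)
From HB Require Import structures.
From mathcomp Require Import all_boot all_order all_algebra finmap.
From mathcomp Require Import all_classical all_reals all_analysis.
From mathcomp Require Import measurable_realfun.

Set Implicit Arguments.
Unset Strict Implicit.
Unset Printing Implicit Defensive.

Import Order.TTheory GRing.Theory Num.Theory.
Import numFieldNormedType.Exports.

Local Open Scope classical_set_scope.
Local Open Scope ring_scope.

(* [T] equipped with the sigma-algebra of all subsets, so that every function
   on it is a random variable. *)
Definition discrete_type (T : Type) : Type := T.

HB.instance Definition _ (T : pointedType) :=
  Pointed.copy (discrete_type T) T.
HB.instance Definition _ (T : pointedType) :=
  @isMeasurable.Build default_measure_display (discrete_type T)
    discrete_measurable discrete_measurable0
    discrete_measurableC discrete_measurableU.

Section uniform.
Context (R : realType) (T : pointedType).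
Implicit Types (A : set T) (f : T -> R).

Lemma discrete_typeP (A : set (discrete_type T)) : measurable A.
Proof. by []. Qed.

(* The Dirac mass is a dummy value, used when [A] is empty or infinite. *)
Definition uniform_law A : probability (discrete_type T) R :=
  mnormalize (mrestr counting (discrete_typeP A)) (\d_(point : discrete_type T)).

(* [E (f X)] for [X] uniformly distributed on [A]: the sample space carries
   the law of [X] and [X] is the identity. *)
Definition uniform_mean A f : R := fine 'E_(uniform_law A)[f].

Let uniform_lawE A B : finite_set A -> A !=set0 ->
  uniform_law A B = ((#|` fset_set (B `&` A)|)%:R / (#|` fset_set A|)%:R)%:E.
Proof.
move=> finA [x Ax].
have A0 : (0 < #|` fset_set A|)%N.
  rewrite lt0n cardfs_eq0; apply/eqP => /(fset_set_set0 finA) A0.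
  by rewrite A0 in Ax.
rewrite /uniform_law/= /mnormalize/= /mrestr/= setTI.
have cA : counting A = (#|` fset_set A|)%:R%:E :> \bar R.
  by rewrite /counting asboolT.
rewrite !cA orbF eqe pnatr_eq0 eqn0Ngt A0/=.
by rewrite /counting asboolT ?EFinM//; exact: finite_setIr.
Qed.

Lemma uniform_meanE A f : finite_set A -> A !=set0 -> (forall x, 0 <= f x) ->
  uniform_mean A f = (\sum_(x <- fset_set A) f x) / (#|` fset_set A|)%:R.
Proof.
move=> finA A0 f0.
pose P := uniform_law A.
have mf (D : set (discrete_type T)) :
  @measurable_fun _ _ (discrete_type T) (\bar R) D (EFin \o f) by [].
have PAC : P (~` A) = 0%E.
  by rewrite uniform_lawE// setICl fset_set0 cardfs0 mul0r.
have P1 x : A x -> P [set x] = ((#|` fset_set A|)%:R^-1)%:E.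
  move=> Ax; rewrite uniform_lawE//.
  have -> : [set x] `&` A = [set x] by apply: setIidl => y ->.
  by rewrite fset_set1 cardfs1 mul1r.
have bigA : \big[setU/set0]_(x <- fset_set A) [set x] = A.
  by rewrite bigsetU_fset_set//= (bigcup_imset1 A id) image_id.
rewrite /uniform_mean unlock.
suff -> : (\int[P]_x (f x)%:E)%E =
    ((\sum_(x <- fset_set A) f x) / (#|` fset_set A|)%:R)%:E by [].
rewrite (@ge0_negligible_integral _ _ _ P setT (~` A))//; last first.
  by move=> x _; rewrite lee_fin.
rewrite setTD setCK -{1}bigA.
rewrite (@ge0_integral_bigsetU _ _ _ P _ (fun x => [set x]))//; first last.
- by move=> x _; rewrite lee_fin.
- by move=> x y _ _ [z [-> ->]].
- exact: fset_uniq.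
rewrite mulr_suml -sumEFin big_seq [RHS]big_seq; apply: eq_bigr => x.
rewrite in_fset_set// inE => Ax.
rewrite (@eq_integral _ _ _ P _ (cst (f x)%:E)); last first.
  by move=> y; rewrite inE => ->.
by rewrite integral_cst// EFinM; congr (_ * _)%E; exact: P1.
Qed.

End uniform.

Section discrete_berwald.
Context {R : realType}.
Implicit Types (n : nat) (p : R).

Definition convex_body n (K : set 'rV[R]_n) : Prop :=
  [/\ compact K, @convex_set R 'rV[R]_n K & K° !=set0].

Definition inner n (x y : 'rV[R]_n) : R := \sum_i x 0 i * y 0 i.

Definition e_last n : 'rV[R]_n.+1 := delta_mx 0 ord_max.

Definition lattice_points n (L : set 'rV[R]_n) : set 'rV[R]_n :=
  L `&` [set x | forall i, x 0 i \is a Num.int].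

(* For bounded [L]: [fset_set] sends infinite sets to the empty set. *)
Definition G n (L : set 'rV[R]_n) : nat := #|` fset_set (lattice_points L)|.

Definition open_cube n : set 'rV[R]_n := [set x | forall i, -1 < x 0 i < 1].

Definition minkowski_sum n (A B : set 'rV[R]_n) : set 'rV[R]_n :=
  [set a + b | a in A & b in B].

(* The maximum is required to be attained, hence there is a lattice point. *)
Definition max_last_ge1 n (K : set 'rV[R]_n.+1) : Prop :=
  exists m : R,
    let S := [set `|inner x (e_last n)| | x in lattice_points K] in
    [/\ S m, ubound S m & 1 <= m].

(* [(E |<X, e_n>|^p)^(1/p)] for [X] uniform on the lattice points of [L]. *)
Definition last_moment n (L : set 'rV[R]_n.+1) p : R :=
  uniform_mean (lattice_points L) (fun x => `|inner x (e_last n)| `^ p)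
    `^ p^-1.

Definition D0 n (K : set 'rV[R]_n.+1) p : R :=
  let KC := minkowski_sum K (@open_cube n.+1) in
  (1 + last_moment KC p * ((G KC)%:R / (G K)%:R) `^ p^-1) / last_moment K p.

End discrete_berwald.

(* Main.v *)
Require Import Defs.
From mathcomp Require Import all_boot all_order all_algebra finmap.
From mathcomp Require Import all_classical all_reals all_analysis.
From mathcomp Require Import zify ring lra.

Import Order.TTheory GRing.Theory Num.Theory.
Set Implicit Arguments.
Unset Strict Implicit.
Unset Printing Implicit Defensive.

Import numFieldNormedType.Exports.

Local Open Scope classical_set_scope.
Local Open Scope ring_scope.

(* Brunn-Minkowski for lattice points: if [S] contains every integer point
   within sup-distance less than 1 of [(a + k b)/(k+1)] for [a] in [A] and [b]
   in [B], then [|A| |B|^k <= |S|^(k+1)].  In dimension one a chain of averages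
   running through [A] and then [B] gives [|A| + k |B| <= (k+1) |S|], which the
   layer-cake formula and AM-GM turn into a functional inequality; that one
   tensorizes.
   Put [N = G_n(K)] and [D0(K,p) (E|X_n|^p)^(1/p) = 1 + S], so that
   [N S^p] is the sum of [|y_n|^p] over the lattice points of [K + C_n], and let
   [s = 2 e^2 (1 + S)].  By Markov's inequality, the number of lattice points
   of [K + C_n] at height above [s - 1] is at most [N e^(-2p) / 2].  As in
   Borell's lemma, averaging points of [K] at height above [3ks] with points at
   height at most [s] shows that at most [N e^(-2pk)] lattice points of [K]
   are higher than [3ks].  Hence [E exp(p |X_n| / (3s)) <= e^(3p)], and
   [w^q <= (q/p)^q e^(pw)] bounds the [q]-th moment. *)

(** * Counting integers near averages in dimension one *)

(* [|z - (a + k b) / (k+1)| < 1], cleared of denominators. *)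
Definition near (k : nat) (a b z : int) : bool :=
  `|k.+1%:Z * z - (a + k%:Z * b)| < k.+1%:Z.

Lemma ceil_divz (k : nat) (c : int) :
  exists m : int, c <= k.+1%:Z * m < c + k.+1%:Z.
Proof.
have := divz_eq (- c) k.+1; set d := divz _ _; set r := modz _ _ => e.
have r0 : 0 <= r by exact: modz_ge0.
have rk : r < k.+1%:Z by exact: ltz_pmod.
by exists (- d); lia.
Qed.

(* Invariant: after visiting [c], the hits up to [m = ceil (c / (k+1))] exceed
   the total weight by at least the rounding error [(k+1) m - c]. *)
Lemma chain_hits (k : nat) (x : nat * int) (s : seq (nat * int)) :
  all (fun y => y.1 <= k.+1)%N s ->
  path (fun x y => x.2 + y.1%:Z <= y.2) x s ->
  exists (H : seq int) (m : int), let c := (last x s).2 in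
    [/\ uniq H, {in H, forall z, z <= m},
     {in H, forall z, exists2 y, y \in x :: s & `|k.+1%:Z * z - y.2| < k.+1%:Z},
     c <= k.+1%:Z * m < c + k.+1%:Z &
     k.+1%:Z + (\sum_(y <- s) y.1)%:Z + (k.+1%:Z * m - c)
       <= k.+1%:Z * (size H)%:Z].
Proof.
elim/last_ind: s => [_ _|s [d e] IH].
  have [m mP] := ceil_divz k x.2.
  have xx : x \in [:: x] by rewrite inE.
  (* A multiple of k+1 is hit by its quotient alone, any other value by both neighbouring
     integers. *)
  have [e|ne] := eqVneq (k.+1%:Z * m) x.2.
    exists [:: m], m; split => //=.
    - by move=> z; rewrite inE => /eqP ->.
    - by move=> z; rewrite inE => /eqP ->; exists x => //; lia.
    - by rewrite big_nil; lia.
  exists [:: m; m - 1], m; split => //=.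
  - by rewrite inE andbT; lia.
  - by move=> z; rewrite !inE => /orP[] /eqP ->; lia.
  - by move=> z; rewrite !inE => /orP[] /eqP ->; exists x => //; lia.
  - by rewrite big_nil; lia.
rewrite all_rcons rcons_path last_rcons /= => /andP[yk /IH{}IH] /andP[/IH{IH}].
move=> [H [m [uH Hm Hs]]]; move: (last x s).2 => c mP szH cy.
have [m' mP'] := ceil_divz k e.
have Hs' z : z \in H ->
    exists2 y', y' \in x :: rcons s (d, e) & `|k.+1%:Z * z - y'.2| < k.+1%:Z.
  move=> /Hs [y' y'P zy']; exists y' => //.
  by rewrite -rcons_cons mem_rcons inE y'P orbT.
have yy : (d, e) \in x :: rcons s (d, e).
  by rewrite -rcons_cons mem_rcons mem_head.
have mm : m <= m'.
  have /orP[//|h] : (m <= m') || (m' + 1 <= m) by lia.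
  have : k.+1%:Z * (m' + 1) <= k.+1%:Z * m by rewrite ler_pM2l.
  lia.
have szy : (\sum_(z <- rcons s (d, e)) z.1 = \sum_(z <- s) z.1 + d)%N.
  by rewrite -cats1 big_cat big_seq1.
rewrite szy {szy}.
(* If the ceiling moves by at most 1, the drop of the rounding error pays for the weight d <= e - c.
   On a larger jump the bound d <= k+1 does, since m' and, off multiples of k+1, also m' - 1 are new
   hits. *)
have [f|[f|[l f]]] : m' = m \/ m' = m + 1 \/ exists l : nat, m' = m + 2 + l%:Z.
- have [->|ne] := eqVneq m' m; [by left|right].
  have [->|ne'] := eqVneq m' (m + 1); [by left|right].
  by exists (absz (m' - m - 2)%R); lia.
- exists H, m; subst m'; split => //; lia.
- subst m'; exists (m + 1 :: H), (m + 1); split => //=.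
  + by rewrite uH andbT; apply/negP => /Hm; lia.
  + by move=> z; rewrite inE => /orP[/eqP ->|/Hm]; lia.
  + by move=> z; rewrite inE => /orP[/eqP ->|/Hs'//]; exists (d, e) => //=; lia.
  + lia.
- have [e0|ne] := eqVneq (k.+1%:Z * m') e.
    exists (m' :: H), m'; split => //=.
    + by rewrite uH andbT; apply/negP => /Hm; lia.
    + by move=> z; rewrite inE => /orP[/eqP ->|/Hm]; lia.
    + by move=> z; rewrite inE => /orP[/eqP ->|/Hs'//]; exists (d, e) => //=; lia.
    + by lia.
  exists [:: m', m' - 1 & H], m'; split => //=.
  + rewrite uH andbT inE; apply/andP; split; last first.
      by apply/negP => /Hm; lia.
    apply/negP => /orP[/eqP|/Hm]; lia.
  + by move=> z; rewrite !inE => /or3P[/eqP ->|/eqP ->|/Hm]; lia.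
  + move=> z; rewrite !inE => /or3P[/eqP ->|/eqP ->|/Hs'//];
      exists (d, e) => //=; lia.
  + lia.
Qed.

(* The chain runs through [a + k min B] for [a] in [A], then through
   [max A + k b] for [b] in [B]. *)
Lemma near_card (k : nat) (A B S : {fset int}) :
  A != fset0 -> B != fset0 ->
  (forall a b z, a \in A -> b \in B -> near k a b z -> z \in S) ->
  (#|` A| + k * #|` B| <= k.+1 * #|` S|)%N.
Proof.
move=> A0 B0 AB_S.
have enum_sorted (X : {fset int}) : X != fset0 -> exists (x : int) s,
    [/\ path <%O x s, (size s).+1 = #|` X| & x :: s =i X].
  move=> X0; case e : (sort <=%O (enum_fset X)) => [|x s].
    by move: X0; rewrite -cardfs_eq0 -(size_sort <=%O X) e.
  have eX : x :: s =i X by move=> y; rewrite -e mem_sort.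
  exists x, s; split => //.
    by rewrite -[path _ _ _]/(sorted _ (x :: s)) -e sort_lt_sorted fset_uniq.
  by rewrite -[LHS]/(size (x :: s)) -e size_sort.
have [a0 [sa [pa <- ea]]] := enum_sorted _ A0.
have [b0 [sb [pb <- eb]]] := enum_sorted _ B0.
(* The weights are the least increments of a + k b: 1 along [A], k along [B]. With the initial k+1
   of [chain_hits] the total is (k+1) + (|A|-1) + k(|B|-1) = |A| + k|B|. *)
pose fa (a : int) : nat * int := (1%N, a + k%:Z * b0).
pose fb (b : int) : nat * int := (k, last a0 sa + k%:Z * b).
have lfa : last (fa a0) (map fa sa) = (1%N, (fb b0).2).
  by rewrite last_map.
have [||H [m [uH _ Hs mP szH]]] :=
    @chain_hits k (fa a0) (map fa sa ++ map fb sb).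
- rewrite all_cat !all_map; apply/andP; split; apply/allP => y _ //=.
- rewrite cat_path path_map; apply/andP; split.
    by apply: sub_path pa => x y /=; lia.
  rewrite lfa; case: (sb) pb => //= b s /andP[b0b pb]; apply/andP; split.
    have : k%:Z * (b0 + 1) <= k%:Z * b by rewrite ler_wpM2l//; lia.
    by lia.
  rewrite path_map; apply: sub_path pb => x y /= xy.
  have : k%:Z * (x + 1) <= k%:Z * y by rewrite ler_wpM2l//; lia.
  by lia.
have : (size H <= #|` S|)%N.
  apply: uniq_leq_size uH _ => z /Hs[y + zy].
  rewrite -cat_cons -map_cons mem_cat => /orP[] /mapP[c cs e]; subst y.
    by apply: AB_S zy; [rewrite -ea|rewrite -eb mem_head].
  by apply: AB_S zy; rewrite -?ea -?eb ?mem_last// inE cs orbT.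
move: szH; rewrite big_cat !big_map /= !big_const_seq !iter_addn_0 !count_predT.
have el : (last (1%N, (fb b0).2) (map fb sb)).2 = (fb (last b0 sb)).2.
  by case: (sb) => //= b s; rewrite last_map.
move: mP; rewrite last_cat lfa el.
move: (fb (last b0 sb)).2 (size sa) (size sb) (size H) => c i j l mP ijl lS.
have : (k.+1 * l <= k.+1 * #|` S|)%N by rewrite leq_mul2l lS orbT.
by move: (#|` S|) (#|` B|) ijl mP; clear; lia.
Qed.

(** * From cardinalities to a functional inequality *)

(* Layer cake, for a signed combination of finitely many values: induction on
   the number of positive values, subtracting the least of them. *)
Lemma layer_cake (R : realDomainType) (s : seq (R * R)) :
  {in s, forall u, 0 <= u.2} ->
  (forall t, 0 < t -> 0 <= \sum_(u <- s | t <= u.2) u.1) ->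
  0 <= \sum_(u <- s) u.1 * u.2.
Proof.
have [n] := ubnP (count (fun u => 0 < u.2) s); elim: n s => // n IH s.
rewrite ltnS => sn s0 st.
have [/hasP[u us u0]|/hasPn no] := boolP (has (fun u => 0 < u.2) s); last first.
  rewrite big_seq big1// => u us; have := s0 _ us; have := no _ us.
  by rewrite lt_neqAle => /negPf h h0; move: h; rewrite h0 andbT eq_sym =>
    /negbFE/eqP ->; rewrite mulr0.
have [m [m0 [v vs vm] sm]] : exists m, [/\ 0 < m, exists2 v, v \in s & v.2 = m &
    {in s, forall w, 0 < w.2 -> m <= w.2}].
  have : u \in [seq w <- s | 0 < w.2] by rewrite mem_filter u0.
  set p := [seq w <- s | _] => up.
  have [w wp wmin] : exists2 w, w \in p & {in p, forall w', w.2 <= w'.2}.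
    elim: (p) u up {us u0} => // a [|b q] IHq u uq.
      by exists a => [|w']; rewrite ?mem_head// inE => /eqP ->.
    have [w wq wmin] := IHq b (mem_head _ _).
    have [aw|wa] := leP a.2 w.2.
      exists a; rewrite ?mem_head// => w'; rewrite inE => /orP[/eqP ->//|].
      by move=> /wmin; apply: le_trans.
    exists w; first by rewrite inE wq orbT.
    by move=> w'; rewrite inE => /orP[/eqP ->|/wmin//]; exact: ltW.
  move: wp; rewrite mem_filter => /andP[w0 ws]; exists w.2; split => //.
    by exists w.
  by move=> w' w's w'0; apply: wmin; rewrite mem_filter w'0.
(* Values below the least positive value [m] are 0, so the truncation affects only those. *)
pose f (u : R * R) := (u.1, Num.max 0 (u.2 - m)).
have -> : \sum_(u <- s) u.1 * u.2 =
    \sum_(u <- map f s) u.1 * u.2 + m * \sum_(u <- s | m <= u.2) u.1.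
  rewrite big_map mulr_sumr [X in _ + X]big_mkcond -big_split /= big_seq.
  rewrite [RHS]big_seq; apply: eq_bigr => w ws.
  have [mw|wm] := leP m w.2.
    by rewrite (max_r _) ?subr_ge0//; ring.
  have -> : w.2 = 0.
    apply/eqP; rewrite eq_le s0// andbT leNgt; apply/negP => /(sm _ ws).
    by rewrite leNgt wm.
  by rewrite (max_l _) ?sub0r ?oppr_le0 ?(ltW m0)//; ring.
apply: addr_ge0; last by rewrite mulr_ge0 ?st// ltW.
apply: IH.
- apply: leq_trans sn; rewrite count_map.
  have -> : count (preim f (fun u => 0 < u.2)) s = count (fun u => m < u.2) s.
    by apply: eq_count => w; rewrite /f /= lt_max ltxx subr_gt0.
  have b0 : (0 < count (fun u => u.2 == m) s)%N.
    by rewrite -has_count; apply/hasP; exists v => //; apply/eqP.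
  have : (count (predU (fun u => (m < u.2)%R) (fun u => u.2 == m)) s
      <= count (fun u => (0 < u.2)%R) s)%N.
    apply: sub_count => w /= /orP[|/eqP -> //]; exact: lt_trans.
  have := count_predUI (fun u => m < u.2) (fun u => u.2 == m) s.
  rewrite (@eq_count _ (predI _ _) pred0) ?count_pred0; last first.
    by move=> w /=; case: ltgtP.
  by rewrite addn0 => ->; apply: leq_trans; rewrite -addn1 leq_add2l.
- by move=> u' /mapP[w ws ->] /=; rewrite le_max lexx.
- move=> t t0; rewrite big_map /= (eq_bigl (fun u => t + m <= u.2)).
    by apply: st; exact: addr_gt0.
  by move=> w; rewrite le_max leNgt t0 /= lerBrDr.
Qed.

(** AM-GM for k+1 numbers, one equal to [x] and the other k equal to [y]. *)
Lemma weighted_AGM (R : realFieldType) (k : nat) (x y : R) : 0 <= x -> 0 <= y ->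
  x * y ^+ k <= ((x + k%:R * y) / k.+1%:R) ^+ k.+1.
Proof.
move=> x0 y0; pose E (i : 'I_k.+1) := if i == ord0 then x else y.
have := @leif_AGM R 'I_k.+1 predT E.
have E0 : {in predT, forall i, 0 <= E i} by move=> i _; rewrite /E; case: ifP.
move=> /(_ E0) [+ _].
rewrite !big_ord_recl /= cardT size_enum_ord.
under eq_bigr do rewrite /E /=.
under [X in _ + X]eq_bigr do rewrite /E /=.
by rewrite /E eqxx !big_const_ord iter_addr_0 iter_mulr_1 mulr_natl.
Qed.

Lemma seq_argmax (R : realFieldType) (T : eqType) (X : seq T) (f : T -> R) :
  X != [::] -> exists2 x, x \in X & {in X, forall y, f y <= f x}.
Proof.
elim: X => // a [|b X] IH _.
  by exists a => [|y]; rewrite mem_seq1// => /eqP ->.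
have [//|x xX xm] := IH.
have [ax|xa] := leP (f a) (f x).
  exists x; first by rewrite inE xX orbT.
  by move=> y; rewrite inE => /orP[/eqP -> //|/xm].
exists a; first exact: mem_head.
move=> y; rewrite inE => /orP[/eqP -> //|/xm yx].
exact: le_trans yx (ltW xa).
Qed.

(** Scaled to maximum 1, [f] and [g] have non-empty superlevel sets at the same levels, so
    [near_card] compares them with those of [h] level by level; [layer_cake] sums this up and
    [weighted_AGM] returns to products. *)
Lemma discrete_prekopa_leindler (R : realType) (k : nat) (A B S : {fset int})
    (f g h : int -> R) :
  A != fset0 -> B != fset0 ->
  {in A, forall a, 0 < f a} -> {in B, forall b, 0 < g b} ->
  {in S, forall z, 0 <= h z} ->
  (forall a b z, a \in A -> b \in B -> near k a b z ->
     z \in S /\ f a * g b ^+ k <= h z ^+ k.+1) ->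
  (\sum_(a <- A) f a) * (\sum_(b <- B) g b) ^+ k
    <= (\sum_(z <- S) h z) ^+ k.+1.
Proof.
move=> A0 B0 f0 g0 h0 fgh.
have [a1 a1A fa1] : exists2 x, x \in A & {in A, forall y, f y <= f x}.
  apply: (@seq_argmax _ _ (enum_fset A)).
  by apply: contraNneq A0 => e; rewrite -cardfs_eq0 /= e.
have [b1 b1B gb1] : exists2 x, x \in B & {in B, forall y, g y <= g x}.
  apply: (@seq_argmax _ _ (enum_fset B)).
  by apply: contraNneq B0 => e; rewrite -cardfs_eq0 /= e.
set mf := f a1 in fa1; set mg := g b1 in gb1.
have mf0 : 0 < mf by exact: f0.
have mg0 : 0 < mg by exact: g0.
(* This scale for [h] makes f a >= t mf and g b >= t mg imply h z >= t mu. *)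
have [mu mu0 muE] : exists2 mu : R, 0 < mu & mu ^+ k.+1 = mf * mg ^+ k.
  exists ((mf * mg ^+ k) `^ k.+1%:R^-1).
    by rewrite powR_gt0// mulr_gt0// exprn_gt0.
  by rewrite -powR_mulrn ?powR_ge0// -powRrM mulVf ?pnatr_eq0// powRr1// mulr_ge0
    ?exprn_ge0 ?ltW.
(* The weights k+1, -1 and -k turn the partial sum at level t into the difference of the two sides
   of [near_card]. *)
have : 0 <= \sum_(u <- [seq (k.+1%:R, h z / mu) | z <- S] ++
    ([seq (-1, f a / mf) | a <- A] ++ [seq (- k%:R, g b / mg) | b <- B]))
    u.1 * u.2.
  apply: layer_cake.
    move=> u; rewrite !mem_cat => /or3P[] /mapP[w ws ->] /=.
    - by rewrite divr_ge0 ?h0// ltW.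
    - by rewrite divr_ge0 ?ltW// f0.
    - by rewrite divr_ge0 ?ltW// g0.
  move=> t t0; rewrite !big_cat !big_map /=.
  have cnt (T : choiceType) (X : {fset T}) (P : pred T) (c : R) :
      \sum_(i <- X | P i) c = c * (#|` [fset x in X | P x]%fset|)%:R.
    rewrite big_const_seq iter_addr_0 mulr_natr -size_filter.
    by rewrite card_imfset//=.
  rewrite !cnt.
  set At := [fset a in A | _]%fset; set Bt := [fset b in B | _]%fset.
  set St := [fset z in S | _]%fset.
  suff : (#|` At| + k * #|` Bt| <= k.+1 * #|` St|)%N.
    by rewrite -(ler_nat R) natrD !natrM; lra.
  (* Above level 1 the sets [At] and [Bt] are empty; up to level 1 they contain the maximizers, so
     [near_card] applies. *)
  have [t1|t1] := leP t 1; last first.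
    have -> : At = fset0.
      apply/fsetP => a; rewrite !inE; apply/negP => /andP[aA].
      rewrite ler_pdivlMr// => h1; have := fa1 _ aA.
      rewrite leNgt => /negP; apply; apply: lt_le_trans h1.
      by rewrite ltr_pMl.
    have -> : Bt = fset0.
      apply/fsetP => b; rewrite !inE; apply/negP => /andP[bB].
      rewrite ler_pdivlMr// => h1; have := gb1 _ bB.
      rewrite leNgt => /negP; apply; apply: lt_le_trans h1.
      by rewrite ltr_pMl.
    by rewrite !cardfs0 muln0.
  apply: near_card.
  - apply/fset0Pn; exists a1; rewrite !inE a1A /=.
    by rewrite -/mf divff ?gt_eqF.
  - apply/fset0Pn; exists b1; rewrite !inE b1B /=.
    by rewrite -/mg divff ?gt_eqF.
  move=> a b z; rewrite !inE => /andP[aA] + /andP[bB] + nz.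
  rewrite !ler_pdivlMr// => ta tb.
  have [zS fgz] := fgh _ _ _ aA bB nz; rewrite zS /=.
  rewrite -(@ler_pXn2r _ k.+1)// ?nnegrE ?h0 ?mulr_ge0 ?(ltW t0) ?(ltW mu0)//.
  apply: le_trans fgz; rewrite exprMn muE exprS mulrACA -exprMn.
  have tmf : 0 <= t * mf by rewrite mulr_ge0// ltW.
  have tmg : 0 <= t * mg by rewrite mulr_ge0// ltW.
  apply: ler_pM => //; first exact: exprn_ge0.
  by apply: lerXn2r; rewrite // nnegrE ltW// g0.
rewrite !big_cat !big_map /= -!mulr_sumr -!mulr_suml.
set F := \sum_(a <- A) f a; set H := \sum_(z <- S) h z.
set Y := \sum_(b <- B) g b => FGH.
have F0 : 0 <= F.
  by rewrite /F big_seq sumr_ge0// => a aA; rewrite ltW// f0.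
have Y0 : 0 <= Y.
  by rewrite /Y big_seq sumr_ge0// => a aA; rewrite ltW// g0.
have : F / mf + k%:R * (Y / mg) <= k.+1%:R * (H / mu) by lra.
have F0' : 0 <= F / mf by rewrite divr_ge0// ltW.
have Y0' : 0 <= Y / mg by rewrite divr_ge0// ltW.
rewrite -ler_pdivrMl ?ltr0n// mulrC => h1.
have H0 : 0 <= H by rewrite /H big_seq sumr_ge0.
have : (F / mf) * (Y / mg) ^+ k <= (H / mu) ^+ k.+1.
  apply: le_trans (weighted_AGM k F0' Y0') _; apply: lerXn2r => //; rewrite nnegrE.
    by rewrite divr_ge0// addr_ge0// mulr_ge0.
  by rewrite divr_ge0// ltW.
rewrite !expr_div_n mulf_div -muE ler_pM2r//.
by rewrite invr_gt0 exprn_gt0.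
Qed.

(** * Brunn-Minkowski for lattice points in every dimension *)

(* The inequality tensorizes: apply [discrete_prekopa_leindler] to the numbers
   of points of [A], [B] and [S] over each first coordinate. *)
Lemma discrete_brunn_minkowski (R : realType) (k n : nat)
    (A B S : {fset 'rV[int]_n}) :
  A != fset0 -> B != fset0 ->
  (forall a b z : 'rV[int]_n, a \in A -> b \in B ->
     (forall i, near k (a 0 i) (b 0 i) (z 0 i)) -> z \in S) ->
  #|` A|%:R * #|` B|%:R ^+ k <= #|` S|%:R ^+ k.+1 :> R.
Proof.
elim: n A B S => [|n IH] A B S A0 B0 AB_S.
  have card1 (X : {fset 'rV[int]_0}) : X != fset0 -> #|` X| = 1%N.
    move=> /fset0Pn[x xX]; have -> : X = [fset x]%fset.
      apply/fsetP => y; rewrite inE; apply/idP/eqP => [_|->//].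
      by apply/rowP => -[].
    by rewrite cardfs1.
  rewrite !card1// ?expr1n ?mulr1//.
  move: A0 B0 => /fset0Pn[a aA] /fset0Pn[b bB].
  by apply/fset0Pn; exists a; apply: AB_S aA bB _ => -[].
pose fib (X : {fset 'rV[int]_n.+1}) c :=
  [fset x : 'rV[int]_n.+1 in X | x 0 ord0 == c]%fset.
pose sec X c := [fset col' ord0 x | x : 'rV[int]_n.+1 in fib X c]%fset.
pose proj (X : {fset 'rV[int]_n.+1}) :=
  [fset x 0 ord0 | x : 'rV[int]_n.+1 in X]%fset.
have card_sec X c : #|` sec X c| = #|` fib X c|.
  rewrite card_in_imfset// => x y; rewrite !inE /= => /andP[_ /eqP xc].
  move=> /andP[_ /eqP yc] /rowP xy; apply/rowP => i.
  case: (unliftP ord0 i) => [j ->|->]; last by rewrite xc yc.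
  by have := xy j; rewrite !mxE.
have cardE (X : {fset 'rV[int]_n.+1}) :
    #|` X|%:R = \sum_(c <- proj X) (#|` sec X c|)%:R :> R.
  rewrite -sum1_size natr_sum.
  rewrite (@partition_big_imfset _ _ _ _ _ (fun x : 'rV[int]_n.+1 => x 0 ord0)).
  apply: eq_bigr => c _; rewrite card_sec.
  by rewrite card_imfset//= size_filter -sum1_count natr_sum.
have proj0 (X : {fset 'rV[int]_n.+1}) : X != fset0 -> proj X != fset0.
  by move=> /fset0Pn[x xX]; apply/fset0Pn; exists (x 0 ord0); apply: in_imfset.
have sec0 X c : c \in proj X -> sec X c != fset0.
  move=> /imfsetP[x /= xX ->]; apply/fset0Pn; exists (col' ord0 x).
  by apply: in_imfset; rewrite !inE /= xX eqxx.
have sec_gt0 X c : c \in proj X -> 0 < #|` sec X c|%:R :> R.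
  by move=> /sec0; rewrite ltr0n cardfs_gt0.
rewrite !cardE; apply: discrete_prekopa_leindler; rewrite ?proj0//.
- exact: sec_gt0.
- exact: sec_gt0.
move=> a b z aA bB nz.
have abz : #|` sec A a|%:R * #|` sec B b|%:R ^+ k <= #|` sec S z|%:R ^+ k.+1 :> R.
  apply: IH; rewrite ?sec0// => a' b' w.
  move=> /imfsetP[a'' /= + ->] /imfsetP[b'' /= + ->].
  rewrite !inE => /andP[a''A /eqP a''a] /andP[b''B /eqP b''b] abw.
  pose w' : 'rV[int]_n.+1 := \row_i oapp (fun j => w 0 j) z (unlift ord0 i).
  apply/imfsetP; exists w' => /=; last first.
    by apply/rowP => j; rewrite !mxE liftK.
  rewrite !inE mxE unlift_none /= eqxx andbT.
  apply: AB_S a''A b''B _ => i; rewrite mxE.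
  case: unliftP => [j ->|->] /=; last by rewrite a''a b''b.
  by have := abw j; rewrite !mxE.
split=> //.
(* A positive count over [z] shows that [S] has a point there, so [z] lies in [proj S]. *)
have : 0 < #|` sec S z|%:R ^+ k.+1 :> R.
  by apply: lt_le_trans abz; rewrite mulr_gt0 ?exprn_gt0 ?sec_gt0.
have [e|] := posnP #|` sec S z|; first by rewrite e expr0n ltxx.
rewrite cardfs_gt0 => /fset0Pn[w /imfsetP[x /= + _]] _.
by rewrite !inE => /andP[xS /eqP <-]; apply: in_imfset.
Qed.

(** Coordinatewise floor is injective on integral vectors and carries the problem over to integer
    vectors. *)
Lemma lattice_brunn_minkowski (R : realType) (k n : nat)
    (A B S : {fset 'rV[R]_n}) :
  A != fset0 -> B != fset0 ->
  {in A, forall x : 'rV[R]_n, forall i, x 0 i \is a Num.int} ->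
  {in B, forall x : 'rV[R]_n, forall i, x 0 i \is a Num.int} ->
  {in S, forall x : 'rV[R]_n, forall i, x 0 i \is a Num.int} ->
  (forall a b z : 'rV[R]_n, a \in A -> b \in B ->
     (forall i, z 0 i \is a Num.int) ->
     (forall i, `|z 0 i - (a 0 i + k%:R * b 0 i) / k.+1%:R| < 1) -> z \in S) ->
  #|` A|%:R * #|` B|%:R ^+ k <= #|` S|%:R ^+ k.+1 :> R.
Proof.
move=> A0 B0 Aint Bint Sint AB_S.
pose phi (x : 'rV[R]_n) : 'rV[int]_n := map_mx Num.floor x.
have card_phi (X : {fset 'rV[R]_n}) :
    {in X, forall x : 'rV[R]_n, forall i, x 0 i \is a Num.int} ->
    #|` phi @` X|%fset = #|` X|.
  move=> Xint; rewrite card_in_imfset//= => x y xX yX /rowP xy.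
  apply/rowP => i; have := xy i; rewrite !mxE => fxy.
  by rewrite -[LHS]floorK ?Xint// fxy floorK// Xint.
have phi0 (X : {fset 'rV[R]_n}) : X != fset0 -> (phi @` X)%fset != fset0.
  by move=> /fset0Pn[x xX]; apply/fset0Pn; exists (phi x); apply: in_imfset.
rewrite -!card_phi//; apply: discrete_brunn_minkowski; rewrite ?phi0//.
move=> _ _ z /imfsetP[a /= aA ->] /imfsetP[b /= bB ->] abz.
apply/imfsetP; exists (map_mx intr z) => /=; last first.
  by apply/rowP => i; rewrite !mxE intrKfloor.
apply: (AB_S _ _ _ aA bB) => i; rewrite !mxE ?intr_int//.
have := abz i; rewrite /near !mxE -(ltr_int R) intr_norm
  !(rmorphB, rmorphD, rmorphM) /=.
rewrite (floorK (Aint _ aA i)) (floorK (Bint _ bB i)) => h.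
rewrite -(@ltr_pM2l _ k.+1%:R) ?ltr0n// mulr1.
rewrite -[X in X * _]ger0_norm ?ler0n// -normrM mulrBr.
by rewrite [X in _ - X]mulrC divfK ?pnatr_eq0.
Qed.

(** * Power means and moments from tail counts *)

(** Let m be the mean of v^p. Young's inequality with exponent r = q/p, applied to v^p / m and 1 and
    summed over [A], bounds m^r by the mean of v^q. *)
Lemma jensen_powR (R : realType) (T : choiceType) (A : {fset T}) (v : T -> R)
    (p q : R) :
  A != fset0 -> (forall x, 0 <= v x) -> 1 <= p -> p <= q ->
  ((\sum_(x <- A) v x `^ p) / #|` A|%:R) `^ p^-1 <=
  ((\sum_(x <- A) v x `^ q) / #|` A|%:R) `^ q^-1.
Proof.
move=> A0 v0 p1; rewrite le_eqVlt => /predU1P[->//|pq].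
have p0 : 0 < p by lra.
have q0 : 0 < q by lra.
have N0 : 0 < #|` A|%:R :> R by rewrite ltr0n cardfs_gt0.
set m := (\sum_(x <- A) v x `^ p) / _.
have : 0 <= m
  by apply: divr_ge0; [apply: sumr_ge0 => x _; exact: powR_ge0|exact: ltW].
rewrite le_eqVlt => /predU1P[<-|m0].
  by rewrite powR0 ?powR_ge0// gt_eqF// invr_gt0.
pose r := q / p.
have r1 : 1 < r by rewrite /r ltr_pdivlMr// mul1r.
have mr : m `^ r <= (\sum_(x <- A) v x `^ q) / #|` A|%:R.
  have mr0 : 0 < m `^ r by rewrite powR_gt0.
  have rr' : r^-1 + (r / (r - 1))^-1 = 1 by field; lra.
  have young x : v x `^ p / m <=
      v x `^ q / m `^ r / r + (r / (r - 1))^-1.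
    have um0 : 0 <= v x `^ p / m by rewrite divr_ge0 ?powR_ge0// ltW.
    have -> : v x `^ q / m `^ r = (v x `^ p / m) `^ r.
      have -> : q = p * r by rewrite /r; field; lra.
      rewrite powRrM -[in LHS](divfK (lt0r_neq0 m0) (v x `^ p)).
      by rewrite (powRM r um0 (ltW m0)) mulfK// lt0r_neq0.
    have := @conjugate_powR _ (v x `^ p / m) 1 r (r / (r - 1)).
    rewrite mulr1 powR1 mul1r; apply => //; first lra.
    by rewrite divr_gt0//; lra.
  have : \sum_(x <- A) v x `^ p / m <=
      \sum_(x <- A) (v x `^ q / m `^ r / r + (r / (r - 1))^-1).
    by apply: ler_sum.
  rewrite big_split /= -!mulr_suml big_const_seq iter_addr_0 count_predT.
  rewrite -/(#|` A|) -[_ *+ _]mulr_natr.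
  have -> : \sum_(x <- A) v x `^ p = #|` A|%:R * m.
    by rewrite /m mulrC divfK// lt0r_neq0.
  rewrite mulfK ?lt0r_neq0//.
  have -> : (r / (r - 1))^-1 = 1 - r^-1 by lra.
  rewrite mulrBl mul1r -lerBlDr opprB addrCA subrr addr0 mulrC.
  rewrite ler_pM2r ?invr_gt0//; last lra.
  by rewrite !ler_pdivlMr// mulrC.
rewrite (_ : p^-1 = r * q^-1); last by rewrite /r; field; lra.
rewrite powRrM; apply: ge0_ler_powR => //; rewrite ?nnegrE ?powR_ge0//.
  by rewrite invr_ge0 ltW.
exact: le_trans (powR_ge0 _ _) mr.
Qed.

Lemma sum_geometric_le2 (R : realFieldType) (x : R) (m : nat) :
  0 <= x -> x <= 2^-1 -> \sum_(k < m) x ^+ k <= 2.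
Proof.
move=> x0 x1; elim: m => [|m IH]; first by rewrite big_ord0.
rewrite big_ord_recl expr0.
under eq_bigr do rewrite /= exprS.
rewrite -mulr_sumr.
have s0 : 0 <= \sum_(k < m) x ^+ k by apply: sumr_ge0 => k _; rewrite exprn_ge0.
have : x * (\sum_(k < m) x ^+ k) <= 2^-1 * 2 by apply: ler_pM.
lra.
Qed.

(** For w > 0 the summand with k < w <= k+1 alone dominates e^(pw), and for w <= 0 the 1 does. This
    reduces exponential moments to counts above integer levels. *)
Lemma expR_le_steps (R : realType) (p w : R) (m : nat) : 0 <= p -> w <= m%:R ->
  expR (p * w) <= 1 + \sum_(k < m | k%:R < w) expR (p * k.+1%:R).
Proof.
move=> p0; elim: m => [|m IH] wm.
  by rewrite big_ord0 addr0 -expR0 ler_expR mulr_ge0_le0.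
rewrite big_mkcond big_ord_recr -big_mkcond /=.
have [mw|/IH h] := ltP m%:R w; last by rewrite addr0.
rewrite -[leLHS]add0r addrA lerD// ?ler_expR ?ler_wpM2l//.
by rewrite addr_ge0// sumr_ge0// => i _; rewrite expR_ge0.
Qed.

(** The tail e^(-2pk) beats the growth e^(p(k+1)), which bounds the mean of e^(pv/s) by e^(3p). *)
Lemma moment_of_tail (R : realType) (T : choiceType) (A : {fset T}) (v : T -> R)
    (s p q : R) :
  0 < s -> (forall x, 0 <= v x) -> 1 <= p -> p <= q ->
  (forall k : nat, (0 < k)%N ->
     #|` [fset x in A | k%:R * s < v x]%fset|%:R
       <= #|` A|%:R * expR (- (2 * p * k%:R))) ->
  \sum_(x <- A) v x `^ q <= #|` A|%:R * (s * (q / p) * expR 3) `^ q.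
Proof.
move=> s0 v0 p1 pq tail.
have p0 : 0 < p by lra.
have q0 : 0 < q by lra.
have N0 : 0 <= #|` A|%:R :> R by exact: ler0n.
have E2 : 2 <= expR p by apply: le_trans (expR_ge1Dx p); lra.
have [m vm] : exists m : nat, {in A, forall x, v x / s <= m%:R}.
  have [m mP] : exists m : nat, \sum_(x <- A) v x / s <= m%:R.
    by exists (Num.bound (\sum_(x <- A) v x / s)); rewrite ltW//
      archi_boundP// sumr_ge0// => x _; rewrite divr_ge0// ltW.
  exists m => x xA; apply: le_trans mP; rewrite (big_rem x)//= lerDl.
  by rewrite sumr_ge0// => y _; rewrite divr_ge0// ltW.
have expsum : \sum_(x <- A) expR (p * (v x / s)) <= #|` A|%:R * expR (3 * p).
  apply: (@le_trans _ _ (\sum_(x <- A)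
      (1 + \sum_(k < m | k%:R * s < v x) expR (p * k.+1%:R)))).
    rewrite big_seq [leRHS]big_seq; apply: ler_sum => x xA.
    under eq_bigl do rewrite -ltr_pdivlMr//.
    by apply: expR_le_steps; [exact: ltW|exact: vm].
  rewrite big_split /= big_const_seq iter_addr_0 count_predT -/(#|` A|).
  rewrite (exchange_big_dep xpredT)//=.
  apply: (@le_trans _ _ (#|` A|%:R +
      \sum_(k < m) #|` A|%:R * expR p * expR (- p) ^+ k)).
    rewrite lerD2l; apply: ler_sum => k _.
    rewrite big_const_seq iter_addr_0 -size_filter -[leLHS]mulr_natl.
    have <- : #|` [fset x in A | k%:R * s < v x]%fset| =
        size [seq x <- A | k%:R * s < v x] by rewrite card_imfset.
    apply: (@le_trans _ _
        (#|` A|%:R * expR (- (2 * p * k%:R)) * expR (p * k.+1%:R))).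
      (* At k = 0, outside the range of [tail], the trivial bound by |A| suffices. *)
      rewrite ler_wpM2r ?expR_ge0//; case: (posnP k) => [->|/tail//].
      rewrite mulr0 oppr0 expR0 mulr1 ler_nat; apply: fsubset_leq_card.
      by apply/fsubsetP => x; rewrite !inE => /andP[].
    rewrite -!mulrA ler_wpM2l// -expRM_natl -!expRD ler_expR.
    by rewrite -natr1; lra.
  (* With E = e^p >= 2 the geometric sum is at most 2, which leaves 1 + 2E <= E^3. *)
  rewrite -mulr_sumr -[X in X + _]mulr1 -mulrA -mulrDr ler_wpM2l//.
  have -> : expR (3 * p) = expR p ^+ 3 by rewrite -expRM_natl mulrC.
  have g2 : \sum_(k < m) expR (- p) ^+ k <= 2.
    apply: sum_geometric_le2; first exact: expR_ge0.
    by rewrite expRN lef_pV2 ?posrE ?expR_gt0.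
  have : expR p * (\sum_(k < m) expR (- p) ^+ k) <= expR p * 2.
    by rewrite ler_wpM2l// expR_ge0.
  nra.
have qp0 : 0 <= s * (q / p) by rewrite ltW// mulr_gt0// divr_gt0.
(* From 1 + y <= e^y follows w <= (q/p) e^(pw/q) for w = v x / s; then take q-th powers. *)
have pointwise x : v x `^ q <= (s * (q / p)) `^ q * expR (p * (v x / s)).
  have w0 : 0 <= v x / s by rewrite divr_ge0// ltW.
  have -> : expR (p * (v x / s)) = expR (p * (v x / s) / q) `^ q.
    by rewrite -expRM divfK// gt_eqF.
  rewrite -powRM ?expR_ge0//.
  apply: ge0_ler_powR; rewrite ?nnegrE ?v0 ?(ltW q0)//.
    by rewrite mulr_ge0 ?expR_ge0.
  rewrite [leLHS](_ : _ = s * (q / p) * (p * (v x / s) / q)); last first.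
    by field; rewrite !lt0r_neq0.
  by rewrite ler_wpM2l//; apply: le_trans (expR_ge1Dx _); rewrite lerDr.
apply: (@le_trans _ _
    (\sum_(x <- A) (s * (q / p)) `^ q * expR (p * (v x / s)))).
  by apply: ler_sum.
rewrite -mulr_sumr.
apply: (@le_trans _ _ ((s * (q / p)) `^ q * (#|` A|%:R * expR (3 * p)))).
  by rewrite ler_wpM2l ?powR_ge0.
rewrite mulrCA ler_wpM2l// [leRHS]powRM ?expR_ge0//.
by apply: ler_wpM2l; rewrite ?powR_ge0// -expRM ler_expR; lra.
Qed.

(** * Exponential decay of the tail counts *)

(** Markov's inequality, normalised by [N] rather than |M|. Keeping the level [u] > 0 apart from a S
    allows S = 0. *)
Lemma markov_count (R : realType) (T : choiceType) (M : {fset T}) (v : T -> R)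
    (N S u a p : R) :
  (forall x, 0 <= v x) -> 0 <= N -> 0 <= S -> 0 < a -> 0 < u -> a * S <= u ->
  0 <= p -> \sum_(x <- M) v x `^ p <= N * S `^ p ->
  #|` [fset x in M | u < v x]%fset|%:R <= N / a `^ p.
Proof.
move=> v0 N0 S0 a0 u0 aSu p0 MS.
have up0 : 0 < u `^ p by exact: powR_gt0.
rewrite ler_pdivlMr ?powR_gt0// -(ler_pM2r up0).
have h1 : #|` [fset x in M | u < v x]%fset|%:R * u `^ p <= N * S `^ p.
  apply: le_trans MS; rewrite (bigID (fun x => u < v x)) /=.
  rewrite -[leLHS]addr0; apply: lerD; last first.
    by apply: sumr_ge0 => x _; exact: powR_ge0.
  apply: (@le_trans _ _ (\sum_(x <- M | u < v x) u `^ p)).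
    rewrite big_const_seq iter_addr_0 -size_filter -[leRHS]mulr_natl.
    by rewrite card_imfset.
  apply: ler_sum => x /ltW ux.
  by apply: ge0_ler_powR => //; rewrite nnegrE// ltW.
have h2 : a `^ p * S `^ p <= u `^ p.
  rewrite -powRM ?(ltW a0)//; apply: ge0_ler_powR => //; rewrite nnegrE.
    by rewrite mulr_ge0// ltW.
  exact: ltW.
apply: (@le_trans _ _ (N * S `^ p * a `^ p)).
  by rewrite mulrAC ler_wpM2r// powR_ge0.
by rewrite -mulrA ler_wpM2l// mulrC.
Qed.

(* Borell's argument: [1/(k+1)] of a point at height above [3ks] plus [k/(k+1)]
   of a point at height at most [s] lies at height above [s]. *)
Lemma borell_tail (R : realType) (n : nat) (A M : {fset 'rV[R]_n.+1})
    (S p : R) (k : nat) :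
  let v (x : 'rV[R]_n.+1) := `|x 0 ord_max| in
  let s := 2 * expR 2 * (1 + S) in
  {in A, forall x : 'rV[R]_n.+1, forall i, x 0 i \is a Num.int} ->
  {in M, forall x : 'rV[R]_n.+1, forall i, x 0 i \is a Num.int} ->
  (forall k (a b z : 'rV[R]_n.+1), a \in A -> b \in A ->
     (forall i, z 0 i \is a Num.int) ->
     (forall i, `|z 0 i - (a 0 i + k%:R * b 0 i) / k.+1%:R| < 1) -> z \in M) ->
  1 <= p -> 0 <= S -> \sum_(x <- M) v x `^ p <= #|` A|%:R * S `^ p ->
  (0 < k)%N ->
  #|` [fset x in A | k%:R * (3 * s) < v x]%fset|%:R
    <= #|` A|%:R * expR (- (2 * p * k%:R)).
Proof.
move=> v s Aint Mint AM p1 S0 MS k0.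
set Ak := [fset x in A | _]%fset; set N : R := #|` A|%:R.
have N0 : 0 <= N by exact: ler0n.
have [Ak0|Ak0] := eqVneq Ak fset0.
  by rewrite Ak0 cardfs0 mulr_ge0// expR_ge0.
have e1 : 1 <= expR 2 :> R by apply: le_trans (expR_ge1Dx 2); lra.
pose a : R := 2 * expR 2.
have a2 : 2 <= a by rewrite /a; lra.
have sE : s = a + a * S by rewrite /s -/a; ring.
have aS0 : 0 <= a * S by rewrite mulr_ge0//; lra.
have AsubM : {subset A <= M}.
  (* For k = 0 the average is the first point itself. *)
  move=> x xA; apply: (AM 0%N x x x) => // [i|i]; first exact: Aint.
  by rewrite mul0r addr0 divr1 subrr normr0.
have v0 x : 0 <= v x by exact: normr_ge0.
(* Markov's fraction: a^p >= 2 e^(2p) as p >= 1. Since [rho] <= 1/2, at least half of [A] has height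
   at most [s]. *)
pose rho : R := expR (- (2 * p)) / 2.
have ap : 2 * expR (2 * p) <= a `^ p.
  rewrite /a powRM ?expR_ge0// -expRM ler_pM ?expR_ge0//.
  by rewrite -[leLHS]powRr1// ler_powR// ler1n.
have count_le u : 0 < u -> a * S <= u ->
    #|` [fset x in M | u < v x]%fset|%:R <= N * rho.
  move=> u0 aSu; have a0 : 0 < a by lra.
  have p0 : 0 <= p by lra.
  apply: le_trans (markov_count v0 N0 S0 a0 u0 aSu p0 MS) _.
  rewrite ler_wpM2l// (_ : rho = (2 * expR (2 * p))^-1); last first.
    by rewrite /rho expRN invfM mulrC.
  by rewrite lef_pV2// posrE ?powR_gt0// mulr_gt0 ?expR_gt0.
have rho1 : 2 * rho <= 1.
  by rewrite /rho mulrC divfK// -[leRHS]expR0 ler_expR; lra.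
have rho0 : 0 <= rho by rewrite divr_ge0 ?expR_ge0.
pose B := [fset x in A | v x <= s]%fset.
have BN : N / 2 <= #|` B|%:R.
  have : #|` B|%:R = N - #|` [fset x in A | s < v x]%fset|%:R.
    rewrite /N -(cardfsID B A) natrD.
    have -> : (A `&` B = B)%fset.
      by apply/fsetP => x; rewrite !inE; case: (x \in A).
    have -> : (A `\` B = [fset x in A | s < v x])%fset.
      by apply/fsetP => x; rewrite !inE ltNge; case: (x \in A); rewrite ?andbT ?andbF.
    by rewrite addrK.
  have : #|` [fset x in A | s < v x]%fset|%:R <=
      #|` [fset x in M | s < v x]%fset|%:R :> R.
    rewrite ler_nat; apply: fsubset_leq_card; apply/fsubsetP => x.
    by rewrite !inE => /andP[/AsubM -> ->].
  have s0 : 0 < s by lra.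
  have aSs : a * S <= s by lra.
  have := count_le s s0 aSs.
  have : N * rho <= N / 2 by rewrite ler_wpM2l//; lra.
  lra.
have Np : 0 < N.
  move: Ak0 => /fset0Pn[x]; rewrite !inE => /andP[xA _].
  by rewrite ltr0n cardfs_gt0; apply/fset0Pn; exists x.
have B0 : B != fset0.
  by rewrite -cardfs_gt0 -(ltr_nat R); apply: lt_le_trans BN; rewrite divr_gt0.
(* The average has height at least [s] and z is less than 1 away. The level s - 1 still exceeds a S,
   because s = a + a S and a >= 2. *)
pose Ms := [fset x in M | s - 1 < v x]%fset.
have BM : #|` Ak|%:R * #|` B|%:R ^+ k <= #|` Ms|%:R ^+ k.+1 :> R.
  apply: lattice_brunn_minkowski => //.
  - by move=> x; rewrite !inE => /andP[/Aint].
  - by move=> x; rewrite !inE => /andP[/Aint].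
  - by move=> x; rewrite !inE => /andP[/Mint].
  move=> x y z; rewrite !inE => /andP[xA vx] /andP[yA vy] zint xyz.
  rewrite (AM k x y z)//=; have := xyz ord_max; move: vx vy; rewrite /v.
  set c := (_ + _) / _ => vx vy zc.
  have cE : c * k.+1%:R = x 0 ord_max + k%:R * y 0 ord_max.
    by rewrite divfK// pnatr_eq0.
  have k1 : 1 <= k%:R :> R by rewrite ler1n.
  have xc : `|x 0 ord_max| <= `|c| * k.+1%:R + k%:R * `|y 0 ord_max|.
    have -> : x 0 ord_max = c * k.+1%:R - k%:R * y 0 ord_max.
      by rewrite cE addrK.
    by apply: le_trans (ler_normB _ _) _; rewrite !normrM !normr_nat.
  have ys : k%:R * `|y 0 ord_max| <= k%:R * s by rewrite ler_wpM2l//.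
  have cz : `|c| <= `|z 0 ord_max| + `|z 0 ord_max - c|.
    by rewrite -[X in `|X| <= _](subKr (z 0 ord_max)) ler_normB.
  (* (k+1)|c| > 3ks - ks = 2ks >= (k+1)s since k >= 1; hence the factor 3. *)
  rewrite ltrBlDr; suff : s <= `|c| by lra.
  have s0 : 0 < s by lra.
  rewrite -natr1 in xc.
  nra.
have Ms_le : #|` Ms|%:R <= N * rho by apply: count_le; lra.
have Mk : #|` Ms|%:R ^+ k.+1 <= (N * rho) ^+ k.+1.
  by apply: lerXn2r => //; rewrite nnegrE// mulr_ge0.
have Bk : (N / 2) ^+ k <= #|` B|%:R ^+ k.
  by apply: lerXn2r => //; rewrite nnegrE// divr_ge0.
have Nk : 0 < (N / 2) ^+ k by rewrite exprn_gt0// divr_gt0.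
(* As N rho = (N/2) e^(-2p), dividing (N rho)^(k+1) by (N/2)^k leaves N rho e^(-2pk). *)
rewrite -(ler_pM2r Nk); apply: (@le_trans _ _ ((N * rho) ^+ k.+1)).
  apply: le_trans (le_trans BM Mk); exact: ler_wpM2l.
rewrite exprS (_ : N * rho = N / 2 * expR (- (2 * p))); last first.
  by rewrite /rho; ring.
rewrite exprMn -expRM_natr (_ : - (2 * p) * k%:R = - (2 * p * k%:R)); last by ring.
rewrite mulrCA [leRHS]mulrC ler_pM2l// ler_wpM2r ?expR_ge0//.
by rewrite -mulrA ler_piMr//; move: rho1; rewrite /rho; lra.
Qed.

(** * Lattice points of convex bodies and the moment comparison *)

Lemma finite_lattice_points (R : realType) (n m : nat) (L : set 'rV[R]_n) :
  (forall x, L x -> forall i, `|x 0 i| <= m%:R) -> finite_set (lattice_points L).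
Proof.
(* The shift by [m] encodes integers in [-m, m] as ordinals below 2m + 1. *)
move=> Lm; pose f (u : 'rV['I_(2 * m).+1]_n) : 'rV[R]_n :=
  \row_i ((u 0 i)%:R - m%:R).
apply: (@sub_finite_set _ _ (f @` setT)); last first.
  by apply: finite_image; exact: finite_finset.
move=> x [/Lm xm xint]; exists (\row_i inord (absz (Num.floor (x 0 i) + m%:Z)%R)) => //.
apply/rowP => i; rewrite !mxE.
have := xm i; rewrite -(floorK (xint i)) intrKfloor.
move: (Num.floor _) => z; rewrite -intr_norm pmulrn ler_int => zm.
rewrite inordK; last by lia.
rewrite !pmulrn -rmorphB /=; congr (_ %:~R); lia.
Qed.

Lemma bounded_coord (R : realType) (n : nat) (K : set 'rV[R]_n.+1) :
  compact K -> exists m : nat, forall x, K x -> forall i, `|x 0 i| <= m%:R.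
Proof.
move=> /compact_bounded[M [_ MK]].
exists (Num.bound (`|M| + 1)) => x Kx i.
have : `|x| <= `|M| + 1.
  by apply: MK Kx; rewrite (le_lt_trans (ler_norm _))// ltrDl.
move=> xM; apply: (@le_trans _ _ `|x|).
  rewrite [leRHS]/Num.norm/= mx_normrE.
  by apply: (@le_bigmax _ _ _ 0 (fun ij => `|x ij.1 ij.2|) (0, i)).
by apply: le_trans xM _; rewrite ltW// archi_boundP// addr_ge0.
Qed.

Lemma inner_e_last (R : realType) (n : nat) (x : 'rV[R]_n.+1) :
  inner x (e_last n) = x 0 ord_max.
Proof.
rewrite /inner (bigD1 ord_max)//= big1 => [|i ne]; last first.
  by rewrite !mxE (negPf ne) andbF mulr0.
by rewrite !mxE !eqxx mulr1 addr0.
Qed.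

Lemma last_momentE (R : realType) (n : nat) (L : set 'rV[R]_n.+1) (p : R) :
  finite_set (lattice_points L) -> lattice_points L !=set0 ->
  last_moment L p =
    ((\sum_(x <- fset_set (lattice_points L)) `|x 0 ord_max| `^ p)
      / (G L)%:R) `^ p^-1.
Proof.
move=> finL L0; rewrite /last_moment uniform_meanE//.
by congr ((_ / _) `^ _); apply: eq_bigr => x _; rewrite inner_e_last.
Qed.

(** Convexity puts the average in [K]; the open cube absorbs the rounding from it to [z]. *)
Lemma convex_body_interpolate (R : realType) (n k : nat) (K : set 'rV[R]_n)
    (a b z : 'rV[R]_n) :
  @convex_set R 'rV[R]_n K -> K a -> K b ->
  (forall i, `|z 0 i - (a 0 i + k%:R * b 0 i) / k.+1%:R| < 1) ->
  minkowski_sum K (@open_cube R n) z.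
Proof.
move=> cK Ka Kb abz.
have l0 : 0 <= k.+1%:R^-1 :> R by rewrite invr_ge0.
have l1 : k.+1%:R^-1 <= 1 :> R by rewrite invf_le1 ?ler1n.
pose c : 'rV[R]_n := k.+1%:R^-1 *: a + (1 - k.+1%:R^-1) *: b.
have Kc : K c.
  by have /set_mem := cK a b (Itv01 l0 l1) (mem_set Ka) (mem_set Kb).
exists c => //; exists (z - c); last by rewrite addrC subrK.
move=> i; rewrite -ltr_norml.
have -> : (z - c) 0 i = z 0 i - (a 0 i + k%:R * b 0 i) / k.+1%:R.
  rewrite !mxE; congr (_ - _); rewrite -natr1; field.
  by rewrite natr1 pnatr_eq0.
exact: abz.
Qed.

Theorem theorem1p2 (R : realType) :
  exists2 C : R, 0 < C &
    forall (n : nat) (K : set 'rV[R]_n.+1) (p q : R),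
      convex_body K -> max_last_ge1 K -> 1 <= p -> p <= q ->
      last_moment K p <= last_moment K q /\
      last_moment K q <= C * (q / p) * D0 K p * last_moment K p.
Proof.
(* The level 3s of [borell_tail] contributes 3 times 2 e^2, and [moment_of_tail] contributes e^3. *)
exists (6 * expR 5); first by rewrite mulr_gt0 ?expR_gt0.
move=> n K p q [cptK cvxK _] [t [[x0 x0K x0t] _ t1]] p1 pq.
have p0 : 0 < p by lra.
have q0 : 0 < q by lra.
set KC := minkowski_sum K (@open_cube R n.+1).
have [m mK] := bounded_coord cptK.
have finK : finite_set (lattice_points K) by exact: finite_lattice_points mK.
have finKC : finite_set (lattice_points KC).
  apply: (@finite_lattice_points _ _ m.+1) => _ [a Ka [b Cb <-]] i.
  rewrite mxE -natr1; apply: le_trans (ler_normD _ _) _.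
  by apply: lerD; [exact: mK|rewrite ltW// ltr_norml; exact: Cb].
have K0 : lattice_points K !=set0 by exists x0.
have KKC : K `<=` KC.
  move=> x Kx; exists x => //; exists 0; last by rewrite addr0.
  by move=> i; rewrite mxE ltr01 ltrN10.
have KC0 : lattice_points KC !=set0.
  by exists x0; case: x0K => Kx0 ?; split => //; exact: KKC.
pose A := fset_set (lattice_points K); pose M := fset_set (lattice_points KC).
have inA x : x \in A -> lattice_points K x by rewrite in_fset_set// inE.
have inM x : lattice_points KC x -> x \in M by rewrite in_fset_set// inE.
pose v (x : 'rV[R]_n.+1) := `|x 0 ord_max|.
have v0 x : 0 <= v x by exact: normr_ge0.
have x0A : x0 \in A by rewrite in_fset_set// inE.
have vx0 : 1 <= v x0 by rewrite /v -inner_e_last x0t.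
have A0 : A != fset0 by apply/fset0Pn; exists x0.
have N0 : 0 < #|` A|%:R :> R by rewrite ltr0n cardfs_gt0.
have lmE r : last_moment K r = ((\sum_(x <- A) v x `^ r) / #|` A|%:R) `^ r^-1.
  by rewrite last_momentE.
split; first by rewrite !lmE; exact: jensen_powR.
pose S := last_moment KC p * ((G KC)%:R / (G K)%:R) `^ p^-1.
have S0 : 0 <= S by rewrite mulr_ge0// powR_ge0.
(* The ratio of counts in [S] replaces the normalisation by |M| with one by |A|; equality holds. *)
have Sp : \sum_(x <- M) v x `^ p <= #|` A|%:R * S `^ p.
  have sM : 0 <= \sum_(x <- M) v x `^ p by apply: sumr_ge0 => x _; exact: powR_ge0.
  have GM : 0 < (G KC)%:R :> R.
    by rewrite ltr0n cardfs_gt0; apply/fset0Pn; exists x0; apply: inM;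
      case: x0K => Kx0 ?; split => //; exact: KKC.
  rewrite /S last_momentE// -powRM ?divr_ge0//.
  rewrite -powRrM mulVf ?gt_eqF// powRr1; last first.
    by rewrite mulr_ge0// divr_ge0.
  by rewrite [X in _ * X]mulrA divfK ?gt_eqF// mulrC divfK ?gt_eqF.
(* The point [x0] of height at least 1 makes the denominator of [D0] positive, so that it cancels;
   division by zero would return 0. *)
have lmp0 : 0 < last_moment K p.
  rewrite lmE powR_gt0// divr_gt0// (big_rem x0)//=.
  apply: ltr_pwDl; first by rewrite powR_gt0//; lra.
  by apply: sumr_ge0 => x _; exact: powR_ge0.
have DK : D0 K p * last_moment K p = 1 + S by rewrite /D0 divfK// gt_eqF.
rewrite -[leRHS]mulrA DK.
have tail (k : nat) (k0 : (0 < k)%N) :=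
  @borell_tail R n A M S p k _ _ _ p1 S0 Sp k0.
have h : \sum_(x <- A) v x `^ q <=
    #|` A|%:R * (3 * (2 * expR 2 * (1 + S)) * (q / p) * expR 3) `^ q.
  apply: moment_of_tail => //.
    by rewrite !mulr_gt0 ?expR_gt0//; lra.
  move=> k k0; apply: tail => //.
  - by move=> x /inA[].
  - by move=> x; rewrite in_fset_set// inE => -[].
  - move=> l a b z /inA[Ka _] /inA[Kb _] zint abz; apply: inM; split => //.
    exact: convex_body_interpolate cvxK Ka Kb abz.
have -> : 6 * expR 5 * (q / p) * (1 + S) =
    ((3 * (2 * expR 2 * (1 + S)) * (q / p) * expR 3) `^ q) `^ q^-1.
  have -> : 5 = 2 + 3 :> R by lra.
  rewrite -powRrM mulfV ?gt_eqF// powRr1; first by rewrite expRD; ring.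
  by rewrite !mulr_ge0 ?expR_ge0 ?invr_ge0//; lra.
rewrite lmE; apply: ge0_ler_powR; rewrite ?nnegrE ?powR_ge0//.
- by rewrite invr_ge0 ltW.
- by rewrite divr_ge0//; apply: sumr_ge0 => x _; exact: powR_ge0.
- by rewrite ler_pdivrMr// mulrC.
Qed.
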